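(* Let $\mathbf A=[\mathbf a(\phi_1),\dots,\mathbf a(\phi_K)]\in\mathbb C^{M\times K}$ and $\mathbf A_+=[\mathbf A,\mathbf a(\phi_{K+1})]\in\mathbb C^{M\times (K+1)}$, where $\mathbf A_+$ has full column rank. Let $\mathbf D=[\mathbf a'(\phi_1),\dots,\mathbf a'(\phi_K)]$ and $\mathbf D_+=[\mathbf D,\mathbf a'(\phi_{K+1})]$, where $\mathbf a'(\phi)=\frac{d\mathbf a(\phi)}{d\phi}$. Let $$\mathbf R_+=\begin{bmatrix}\mathbf R_{\mathbf S}&\mu\\ \mu^{\mathrm H}&\nu\end{bmatrix}\succeq 0$$ be a Hermitian $(K+1)\times(K+1)$ matrix with $\mathbf R_{\mathbf S}\in\mathbb C^{K\times K}$, let $\sigma^2>0$, $T>0$, and put $$\mathbf T=\mathbf D^{\mathrm H}(\mathbf I-\mathbf A\mathbf A^\dagger)\mathbf D,\qquad \mathbf T_+=\mathbf D_+^{\mathrm H}(\mathbf I-\mathbf A_+\mathbf A_+^\dagger)\mathbf D_+ .$$ Assume $\Re(\mathbf T_+\odot\mathbf R_+^{\mathrm H})$ and $\Re(\mathbf T\odot\mathbf R_{\mathbf S}^{\mathrm H})$ are invertible, and define $$\mathrm{CRB}_{Ny}=\frac{\sigma^2}{2T}\big(\Re(\mathbf T\odot\mathbf R_{\mathbf S}^{\mathrm H})\big)^{-1},\qquad \mathrm{CRB}_{Ny+}=\frac{\sigma^2}{2T}\big(\Re(\mathbf T_+\odot\mathbf R_+^{\mathrm H})\big)^{-1}.$$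 Then $$(\mathrm{CRB}_{Ny+})_K\succeq \mathrm{CRB}_{Ny}.$$
   Context: Here $\mathbf a(\phi)=[\exp(j\phi p_1),\dots,\exp(j\phi p_M)]^{\mathrm T}$ ($j=\sqrt{-1}$) is the steering vector of an array with fixed real sensor positions $p_1,\dots,p_M$ (for a uniform linear array $p_m=m-1$), and $\phi_1,\dots,\phi_{K+1}\in\mathbb R$ are spatial phases. $\mathbf X^\dagger=(\mathbf X^{\mathrm H}\mathbf X)^{-1}\mathbf X^{\mathrm H}$ is the Moore--Penrose pseudo-inverse of a full-column-rank matrix; $\odot$ is the Hadamard (entrywise) product; $\Re$ is the entrywise real part; $(\mathbf X)_K$ denotes the leading $K\times K$ principal submatrix of $\mathbf X$; $\mathbf X\succeq\mathbf Y$ means $\mathbf X-\mathbf Y$ is Hermitian positive semidefinite. $\mathrm{CRB}_{Ny}$ is the Cram\'er--Rao bound for $[\phi_1,\dots,\phi_K]$ under Nyquist sampling with $K$ signals having covariance $\mathbf R_{\mathbf S}$, noise variance $\sigma^2$ and $T$ snapshots; $\mathrm{CRB}_{Ny+}$ is the same bound after adding a $(K+1)$st signal. *)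

(* Defs.v *)
From mathcomp Require Import all_boot all_order all_algebra.
From mathcomp Require Import spectral.
From mathcomp Require Import all_classical all_reals all_analysis.
From mathcomp Require Import complex.

Set Implicit Arguments.
Unset Strict Implicit.
Unset Printing Implicit Defensive.

Import Order.TTheory GRing.Theory Num.Theory.

Local Open Scope ring_scope.
Local Open Scope sesquilinear_scope.
Local Open Scope complex_scope.

Section ComplexMatrices.
Variable C : numClosedFieldType.

(* In a numClosedFieldType, [0 <= z] says that z is real and nonnegative. *)
Definition psdmx (n : nat) (X : 'M[C]_n) : Prop :=
  X \is hermsymmx /\ forall x : 'cV[C]_n, 0 <= (x ^t* *m X *m x) 0 0.

Definition hadamard (m n : nat) (X Y : 'M[C]_(m, n)) : 'M[C]_(m, n) :=
  map2_mx *%R X Y.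

(* The real part is taken inside C, so the result is again a matrix over C. *)
Definition Re_mx (m n : nat) (X : 'M[C]_(m, n)) : 'M[C]_(m, n) :=
  map_mx (fun z : C => 'Re z) X.

(* This is the Moore-Penrose inverse only when X has full column rank. *)
Definition pinv_col (m n : nat) (X : 'M[C]_(m, n)) : 'M[C]_(n, m) :=
  invmx (X ^t* *m X) *m X ^t*.

(* D^H (I - A A^+) D *)
Definition proj_gram (m n : nat) (A D : 'M[C]_(m, n)) : 'M[C]_n :=
  D ^t* *m (1%:M - A *m pinv_col A) *m D.

End ComplexMatrices.

Section Steering.
Variable R : realType.

Definition cexp (z : R[i]) : R[i] :=
  (expR (complex.Re z))%:C *
  (cos (complex.Im z) +i* sin (complex.Im z)).

(* Derivative of a complex-valued function of a real variable. *)
Definition cderive1 (f : R -> R[i]) (t : R) : R[i] :=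
  derive1 (fun s => complex.Re (f s)) t +i*
  derive1 (fun s => complex.Im (f s)) t.

Variables (M : nat) (p : 'I_M -> R).

Definition steer (phi : R) : 'cV[R[i]]_M :=
  \col_m cexp ('i * (phi * p m)%:C).

Definition dsteer (phi : R) : 'cV[R[i]]_M :=
  \col_m cderive1 (fun t => steer t m 0) phi.

Definition steer_mx (K : nat) (phi : 'I_K -> R) : 'M[R[i]]_(M, K) :=
  \matrix_(m < M, k < K) steer (phi k) m 0.

Definition dsteer_mx (K : nat) (phi : 'I_K -> R) : 'M[R[i]]_(M, K) :=
  \matrix_(m < M, k < K) dsteer (phi k) m 0.

End Steering.

(* Main.v *)
Require Import Defs.
From mathcomp Require Import all_boot all_order all_algebra.
From mathcomp Require Import spectral.
From mathcomp Require Import all_classical all_reals all_analysis.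
From mathcomp Require Import complex.

Import Order.TTheory GRing.Theory Num.Theory.

Local Open Scope ring_scope.
Local Open Scope sesquilinear_scope.

(** Both information matrices are [Re (T o R^H)].  Adding a column to [A] shrinks
    the projector [I - A A^+], so [T - (T_+)_K] is a Gram matrix; by the Schur
    product theorem [F - (F_+)_K] is positive semidefinite, where [F] and [F_+]
    are the two information matrices.  With [J] the inclusion of the first [K]
    coordinates and [Z = F_+^-1 J - J F^-1], completing the square gives
    [(F_+^-1)_K - F^-1 = Z^H F_+ Z + F^-1 (F - (F_+)_K) F^-1], in which both
    summands are positive semidefinite. *)

Section PsdMatrices.
Set Implicit Arguments.
Unset Strict Implicit.
Variable C : numClosedFieldType.

(** * Adjoints and positive semidefinite matrices *)

Lemma adjmxM m n q (X : 'M[C]_(m, n)) (Y : 'M[C]_(n, q)) :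
  (X *m Y) ^t* = Y ^t* *m X ^t*.
Proof. by rewrite trmx_mul map_mxM. Qed.

Lemma adjmxB m n (X Y : 'M[C]_(m, n)) : (X - Y) ^t* = X ^t* - Y ^t*.
Proof. by rewrite linearB /= map_mxB. Qed.

Lemma adjmx_inv n (X : 'M[C]_n) : (invmx X) ^t* = invmx (X ^t*).
Proof. by rewrite trmx_inv map_invmx. Qed.

Lemma adjmx1 n : (1%:M : 'M[C]_n) ^t* = 1%:M.
Proof. by rewrite trmx1 map_mx1. Qed.

Lemma hermsymmxP n (X : 'M[C]_n) : (X \is hermsymmx) <-> X ^t* = X.
Proof.
by split=> [/is_hermitianmxP|XE]; [|apply/is_hermitianmxP];
  rewrite expr0 scale1r.
Qed.

(** Each diagonal entry of [X X^H] is the sum of the squared moduli of a row of [X]. *)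
Lemma adjmx_mul_eq0 m n (X : 'M[C]_(m, n)) : X *m X ^t* = 0 -> X = 0.
Proof.
move=> X0; apply/matrixP => i j; move/matrixP/(_ i i): X0; rewrite !mxE.
move=> /eqP; rewrite psumr_eq0 => [|k _]; last by rewrite !mxE mul_conjC_ge0.
move=> /allP/(_ j (mem_index_enum _)); rewrite !mxE mul_conjC_eq0.
by move=> /eqP.
Qed.

Lemma psdmxD n (X Y : 'M[C]_n) : psdmx X -> psdmx Y -> psdmx (X + Y).
Proof.
move=> [/hermsymmxP hX pX] [/hermsymmxP hY pY]; split.
  by apply/hermsymmxP; rewrite linearD /= map_mxD hX hY.
by move=> x; rewrite mulmxDr mulmxDl mxE addr_ge0.
Qed.

Lemma psdmxZ n (c : C) (X : 'M[C]_n) : 0 <= c -> psdmx X -> psdmx (c *: X).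
Proof.
move=> c0 [/hermsymmxP hX pX]; split.
  by apply/hermsymmxP; rewrite linearZ /= map_mxZ hX /= conj_Creal ?ger0_real.
by move=> x; rewrite -scalemxAr -scalemxAl mxE mulr_ge0.
Qed.

Lemma psdmx_congr m n (X : 'M[C]_m) (Y : 'M[C]_(m, n)) :
  psdmx X -> psdmx (Y ^t* *m X *m Y).
Proof.
move=> [/hermsymmxP hX pX]; split.
  by apply/hermsymmxP; rewrite !adjmxM trmxCK hX mulmxA.
by move=> x; have := pX (Y *m x); rewrite adjmxM !mulmxA.
Qed.

(* [x^H (B^H B o S) x] is the sum over the rows [b] of [B] of [y^H S y] with
   [y = b o x]. *)
Lemma psdmx_hadamard_gram m n (B : 'M[C]_(m, n)) (S : 'M[C]_n) :
  psdmx S -> psdmx (hadamard (B ^t* *m B) S).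
Proof.
move=> [/hermsymmxP hS pS]; split.
  apply/hermsymmxP/matrixP => i j.
  have Sij : (S j i)^* = S i j by rewrite -[in RHS]hS !mxE.
  rewrite !mxE rmorphM rmorph_sum /= Sij; congr (_ * _).
  by apply: eq_bigr => k _; rewrite !mxE rmorphM /= conjCK mulrC.
move=> x; pose y k : 'cV[C]_n := \col_j (B k j * x j 0).
have -> : (x ^t* *m hadamard (B ^t* *m B) S *m x) 0 0 =
          \sum_k ((y k) ^t* *m S *m y k) 0 0.
  under [RHS]eq_bigr do rewrite mxE; rewrite exchange_big mxE /=.
  apply: eq_bigr => j _; rewrite mxE.
  under [RHS]eq_bigr do rewrite mxE mulr_suml; rewrite exchange_big mulr_suml /=.
  apply: eq_bigr => i _; rewrite !mxE mulr_suml mulr_sumr mulr_suml.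
  apply: eq_bigr => k _; rewrite !mxE rmorphM /=.
  by rewrite (mulrC _ (x i 0)^*) !mulrA (mulrAC _ _ (S i j)).
exact: sumr_ge0.
Qed.

(** The form of the conjugate of [X] at [x] is the conjugate of the form of [X] at the conjugate of
    [x]. This handles real parts, since [Re_mx X] is the average of [X] and its conjugate. *)
Lemma psdmx_conj n (X : 'M[C]_n) : psdmx X -> psdmx (map_mx Num.conj X).
Proof.
move=> [/hermsymmxP hX pX]; split.
  by apply/hermsymmxP; rewrite map_trmx -[in RHS]hX -map_trmx map_trmx.
move=> x; pose z := ((map_mx Num.conj x) ^t* *m X *m map_mx Num.conj x) 0 0.
suff -> : (x ^t* *m map_mx Num.conj X *m x) 0 0 = z^* by rewrite conjC_ge0; exact: pX.
have -> : z^* = (map_mx Num.conj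
    ((map_mx Num.conj x) ^t* *m X *m map_mx Num.conj x)) 0 0 by rewrite mxE.
rewrite !map_mxM; congr ((_ *m _ *m _) 0 0);
  by apply/matrixP => i j; rewrite !mxE /= ?conjCK.
Qed.

Lemma Re_mxE m n (X : 'M[C]_(m, n)) :
  Re_mx X = 2^-1 *: (X + map_mx Num.conj X).
Proof. by apply/matrixP => i j; rewrite !mxE ReE mulrC. Qed.

Lemma psdmx_Re n (X : 'M[C]_n) : psdmx X -> psdmx (Re_mx X).
Proof.
move=> pX; rewrite Re_mxE; apply: psdmxZ; first by rewrite invr_ge0 ler0n.
exact/psdmxD/psdmx_conj.
Qed.

(** * Gram matrices and orthogonal projectors *)

Lemma row_free_gram_unitmx m n (A : 'M[C]_(m, n)) :
  row_free (A ^t*) -> A ^t* *m A \in unitmx.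
Proof.
move=> freeA; rewrite -row_free_unit -kermx_eq0; apply/eqP.
set u := kermx _; have uG : u *m (A ^t* *m A) = 0 by exact: mulmx_ker.
(* With [v = u A^H], the relation [uG] yields [v v^H = u (A^H A) u^H = 0], hence [v = 0]. *)
apply: (row_free_inj freeA); rewrite mul0mx; apply: adjmx_mul_eq0.
by rewrite adjmxM trmxCK mulmxA -(mulmxA u) uG mul0mx.
Qed.

(** When [A^H A] is invertible, this is the orthogonal projector onto the orthogonal complement of
    the column space of [A]. *)
Definition coproj m n (A : 'M[C]_(m, n)) : 'M[C]_m := 1%:M - A *m pinv_col A.

Lemma coproj_adj m n (A : 'M[C]_(m, n)) : (coproj A) ^t* = coproj A.
Proof.
by rewrite /coproj adjmxB adjmx1 /pinv_col !adjmxM adjmx_inv adjmxM trmxCK mulmxA.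
Qed.

Lemma coproj_mul m n (A : 'M[C]_(m, n)) :
  A ^t* *m A \in unitmx -> coproj A *m A = 0.
Proof.
move=> uG; rewrite /coproj /pinv_col mulmxBl mul1mx -!mulmxA mulVmx //.
by rewrite mulmx1 subrr.
Qed.

Lemma coproj_absorb m n q (A : 'M[C]_(m, n)) (Q : 'M[C]_(q, m)) :
  Q *m A = 0 -> Q *m coproj A = Q.
Proof. by move=> QA; rewrite mulmxBr mulmx1 mulmxA QA mul0mx subr0. Qed.

Lemma coproj_idem m n (A : 'M[C]_(m, n)) :
  A ^t* *m A \in unitmx -> coproj A *m coproj A = coproj A.
Proof. by move=> /coproj_mul/coproj_absorb. Qed.

Lemma proj_gramE m n (A D : 'M[C]_(m, n)) : A ^t* *m A \in unitmx ->
  proj_gram A D = (coproj A *m D) ^t* *m (coproj A *m D).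
Proof.
move=> uG; rewrite adjmxM coproj_adj mulmxA -(mulmxA (D ^t*)).
by rewrite coproj_idem.
Qed.

(** * Differences, leading blocks and inverses *)

Lemma hadamardBl m n (X Y Z : 'M[C]_(m, n)) :
  hadamard (X - Y) Z = hadamard X Z - hadamard Y Z.
Proof. by apply/matrixP => i j; rewrite !mxE mulrBl. Qed.

Lemma Re_mxB m n (X Y : 'M[C]_(m, n)) : Re_mx (X - Y) = Re_mx X - Re_mx Y.
Proof. by apply/matrixP => i j; rewrite !mxE raddfB. Qed.

(** Writing truncation as a congruence by [J] lets leading blocks inherit positivity and take part
    in matrix algebra. *)
Lemma ulsubmx_congr n q (X : 'M[C]_(n + q)) :
  ulsubmx X = (col_mx 1%:M 0) ^t* *m X *m col_mx 1%:M 0.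
Proof.
rewrite tr_col_mx map_row_mx trmx1 trmx0 map_mx1 map_mx0.
rewrite -{2}(submxK X) mul_row_block mul_row_col.
by rewrite !mul1mx !mul0mx mulmx1 mulmx0 !addr0.
Qed.

Lemma psdmx_ulsubmx n q (X : 'M[C]_(n + q)) : psdmx X -> psdmx (ulsubmx X).
Proof. by rewrite ulsubmx_congr; exact: psdmx_congr. Qed.

Lemma psdmx_ulsubmx_inv n q (X : 'M[C]_(n + q)) (F : 'M[C]_n) :
  X \in unitmx -> F \in unitmx -> psdmx X -> F ^t* = F ->
  psdmx (F - ulsubmx X) -> psdmx (ulsubmx (invmx X) - invmx F).
Proof.
move=> uX uF pX hF pF.
have hX : X ^t* = X by case: pX => /hermsymmxP.
pose J : 'M[C]_(n + q, n) := col_mx 1%:M 0.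
pose W := invmx F; pose Z := invmx X *m J - J *m W.
have hW : W ^t* = W by rewrite adjmx_inv hF.
have JJ : J ^t* *m J = 1%:M.
  have := ulsubmx_congr (1%:M : 'M[C]_(n + q)).
  by rewrite mulmx1 scalar_mx_block block_mxKul.
suff -> : ulsubmx (invmx X) - invmx F =
    Z ^t* *m X *m Z + W ^t* *m (F - ulsubmx X) *m W.
  by apply: psdmxD; exact: psdmx_congr.
(* Expanding with this form of [X Z], the first summand becomes [J^H X^-1 J - 2 W + W J^H X J W] and
   the second [W - W J^H X J W]. *)
have XZ : X *m Z = J - X *m J *m W by rewrite mulmxBr mulKVmx // mulmxA.
rewrite -(mulmxA (Z ^t*)) XZ !ulsubmx_congr -/J /Z adjmxB !adjmxM adjmx_inv hX hW.
rewrite !mulmxBr !mulmxBl !mulmxA mulmxKV // JJ mul1mx.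
by rewrite -(mulmxA W (J ^t*) J) JJ mulmx1 mulVmx // mul1mx subrK.
Qed.

(** * Appending columns to [A] *)

Lemma coproj_row_mx_absorb m n q (A : 'M[C]_(m, n)) (a : 'M[C]_(m, q)) :
  (row_mx A a) ^t* *m row_mx A a \in unitmx ->
  coproj (row_mx A a) *m coproj A = coproj (row_mx A a).
Proof.
(* The projector annihilates every column of [[A a]], in particular the block [A]. *)
move=> /coproj_mul; rewrite mul_mx_row -row_mx0 => /eq_row_mx[PA _].
exact: coproj_absorb.
Qed.

(** Let [P] and [P'] be the projectors of [A] and [[A a]]. From [P' P = P'] and its adjoint
    [P P' = P'], the difference [P - P'] is Hermitian and idempotent. *)
Lemma coproj_sub_gram m n q (A : 'M[C]_(m, n)) (a : 'M[C]_(m, q)) :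
  A ^t* *m A \in unitmx -> (row_mx A a) ^t* *m row_mx A a \in unitmx ->
  let Q := coproj A - coproj (row_mx A a) in Q = Q ^t* *m Q.
Proof.
move=> uA uAa Q; rewrite {}/Q.
have := coproj_row_mx_absorb uAa; have := coproj_idem uAa.
have := coproj_idem uA; have := coproj_adj (row_mx A a); have := coproj_adj A.
move: (coproj A) (coproj (row_mx A a)) => P Q hP hQ PP QQ QP.
have PQ : P *m Q = Q by rewrite -[RHS]hQ -[in RHS]QP adjmxM hP hQ.
by rewrite adjmxB hP hQ mulmxBr !mulmxBl PP PQ QP QQ subrr subr0.
Qed.

(** A left kernel vector of [A^H], padded with zeros, is a left kernel vector of [[A a]^H]. *)
Lemma row_free_adj_row_mx m n q (A : 'M[C]_(m, n)) (a : 'M[C]_(m, q)) :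
  row_free ((row_mx A a) ^t*) -> row_free (A ^t*).
Proof.
move=> freeAa; rewrite -kermx_eq0; apply/eqP; set u := kermx _.
suff : row_mx u (0 : 'M[C]_(n, q)) = 0.
  by rewrite -row_mx0 => /eq_row_mx[].
apply: (row_free_inj freeAa).
by rewrite tr_row_mx map_col_mx mul_row_col mulmx_ker !mul0mx addr0.
Qed.

Lemma ulsubmx_proj_gram m n q (A D : 'M[C]_(m, n)) (a d : 'M[C]_(m, q)) :
  ulsubmx (proj_gram (row_mx A a) (row_mx D d)) =
  D ^t* *m coproj (row_mx A a) *m D.
Proof.
rewrite /proj_gram tr_row_mx map_col_mx mul_col_mx mul_col_row.
by rewrite block_mxKul.
Qed.

(** The comparison for general matrices, with [S] standing for [R_+^H] and the scalar factor left
    out. *)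
Lemma psdmx_CRB_mono m n q (A D : 'M[C]_(m, n)) (a d : 'M[C]_(m, q))
    (S : 'M[C]_(n + q)) :
  let F := Re_mx (hadamard (proj_gram A D) (ulsubmx S)) in
  let Fplus := Re_mx (hadamard (proj_gram (row_mx A a) (row_mx D d)) S) in
  row_free ((row_mx A a) ^t*) -> psdmx S ->
  F \in unitmx -> Fplus \in unitmx ->
  psdmx (ulsubmx (invmx Fplus) - invmx F).
Proof.
move=> F Fplus freeAa pS uF uFplus.
have uAa := row_free_gram_unitmx freeAa.
have uA := row_free_gram_unitmx (row_free_adj_row_mx freeAa).
have pS' := psdmx_ulsubmx pS.
apply: psdmx_ulsubmx_inv => //.
- by apply: psdmx_Re; rewrite proj_gramE //; exact: psdmx_hadamard_gram.
- suff [/hermsymmxP] : psdmx F by [].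
  by apply: psdmx_Re; rewrite proj_gramE //; exact: psdmx_hadamard_gram.
have -> : ulsubmx Fplus =
    Re_mx (hadamard (D ^t* *m coproj (row_mx A a) *m D) (ulsubmx S)).
  by rewrite -(ulsubmx_proj_gram A D a d); apply/matrixP => i j; rewrite !mxE.
rewrite -Re_mxB -hadamardBl; apply: psdmx_Re.
rewrite /proj_gram -mulmxBl -mulmxBr -/(coproj A).
(* With [Q] the difference of the projectors, [D^H Q D = (Q D)^H (Q D)], so the Schur product step
   applies. *)
rewrite (coproj_sub_gram uA uAa) mulmxA -mulmxA -adjmxM.
exact: psdmx_hadamard_gram.
Qed.

End PsdMatrices.

Local Open Scope complex_scope.

Theorem mainTheorem2 (R : realType) (M K : nat) (p : 'I_M -> R)
    (phi : 'I_K -> R) (phi_new : R)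
    (RS : 'M[R[i]]_K) (mu : 'cV[R[i]]_K) (nu : R[i]) (sigma T : R) :
  let A : 'M[R[i]]_(M, K) := steer_mx p phi in
  let Aplus : 'M[R[i]]_(M, K + 1) := row_mx A (steer p phi_new) in
  let D : 'M[R[i]]_(M, K) := dsteer_mx p phi in
  let Dplus : 'M[R[i]]_(M, K + 1) := row_mx D (dsteer p phi_new) in
  let Rplus : 'M[R[i]]_(K + 1) := block_mx RS mu (mu ^t*) (nu%:M) in
  let TT : 'M[R[i]]_K := proj_gram A D in
  let TTplus : 'M[R[i]]_(K + 1) := proj_gram Aplus Dplus in
  let CRB_Ny : 'M[R[i]]_K :=
    (sigma ^+ 2 / (2 * T))%:C *: invmx (Re_mx (hadamard TT (RS ^t*))) in
  let CRB_Nyplus : 'M[R[i]]_(K + 1) :=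
    (sigma ^+ 2 / (2 * T))%:C *:
      invmx (Re_mx (hadamard TTplus (Rplus ^t*))) in
  \rank Aplus = (K + 1)%N ->
  psdmx Rplus ->
  0 < sigma ^+ 2 ->
  0 < T ->
  Re_mx (hadamard TTplus (Rplus ^t*)) \in unitmx ->
  Re_mx (hadamard TT (RS ^t*)) \in unitmx ->
  psdmx (ulsubmx CRB_Nyplus - CRB_Ny).
Proof.
move=> A Aplus D Dplus Rplus TT TTplus CRB_Ny CRB_Nyplus.
move=> rankA pR sigma_gt0 T_gt0 uFplus uF.
have -> : ulsubmx CRB_Nyplus - CRB_Ny = (sigma ^+ 2 / (2 * T))%:C *:
    (ulsubmx (invmx (Re_mx (hadamard TTplus (Rplus ^t*)))) -
     invmx (Re_mx (hadamard TT (RS ^t*)))).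
  by apply/matrixP => i j; rewrite !mxE mulrBr.
apply: psdmxZ.
  by rewrite ler0c; apply: divr_ge0; [exact: ltW | apply: mulr_ge0; rewrite ?ler0n ?ltW].
have RS_ul : RS ^t* = ulsubmx (Rplus ^t*).
  rewrite -[in LHS](block_mxKul RS mu (mu ^t*) nu%:M).
  by apply/matrixP => i j; rewrite !mxE.
move: uF; rewrite RS_ul => uF; apply: psdmx_CRB_mono => //.
  (* Rank is invariant under transposition and conjugation, so full column rank of [Aplus] makes the
     rows of its adjoint independent. *)
  by rewrite /row_free mxrank_map mxrank_tr rankA.
by case: (pR) => /hermsymmxP ->.
Qed.
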